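(* There are no positive integers $A,B,C$ satisfying $A^3+B^3=C^3$. Equivalently, there are no non-zero integers $x,y,z$ satisfying $x^3+y^3+z^3=0$. *)

(* Defs.v *)
From mathcomp Require Import all_boot all_order all_algebra.

(* Main.v *)
Require Import Defs.
From HB Require Import structures.
From mathcomp Require Import all_boot all_order all_algebra.
From mathcomp Require Import zify ring.
Import Order.TTheory GRing.Theory Num.Theory.
Local Open Scope ring_scope.

(** The proof is an infinite descent in the Eisenstein integers [Z[omega]],
    where [omega^2 + omega + 1 = 0] and where [lam = 1 - omega] is a prime with
    residue field [F_3] and with [lam^2] associated to 3.

    An integral solution of [x^3 + y^3 + z^3 = 0] can be made coprime, and then
    3 divides one of the three numbers ([three_dvd_cubes]), say [z]. It suffices
    to refute the wider equation [x^3 + y^3 = u z^3] with [u] a unit, [x] and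
    [y] comaximal, and [z] a nonzero multiple of [lam]: allowing a unit is what
    makes the descent close up.

    The left-hand side factors as [(x + y)(x + omega y)(x + omega^2 y)]. All
    three factors are divisible by [lam], and after division by [lam] they have
    distinct residues in [F_3], so that replacing [y] by [omega y] or
    [omega^2 y] makes [x + y] divisible by [lam^2] ([normalize_factor]). The
    quotients [a], [b], [c] are pairwise comaximal, their product is
    [u (z / lam)^3], and [a + omega b + omega^2 c = 0]. Each is hence a unit
    times a cube ([comaximal_mul_cube]; bases exist by Euclidean division,
    [eis_bezout]), which turns the linear relation into
    [q^3 + e r^3 = e' p^3] with [e], [e'] units and [lam] dividing [p]. Modulo 3
    the cubes of [q] and [r] are 1 or -1, so that [e] is congruent to 1 or -1,
    hence equal to it ([unit_mod3]), hence a cube. This is an equation of the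
    original form, and [p] has smaller norm than [z] ([descent_step]). *)

(** * Divisibility and comaximality *)

Definition divides {R : comNzRingType} (a b : R) : Prop :=
  exists c, b = c * a.

Definition comaximal {R : comNzRingType} (a b : R) : Prop :=
  exists s t, s * a + t * b = 1.

Lemma comaximal_sym (R : comNzRingType) (a b : R) :
  comaximal a b -> comaximal b a.
Proof. by move=> [s [t e]]; exists t, s; rewrite addrC. Qed.

Lemma comaximalMr (R : comNzRingType) (a b c : R) :
  comaximal a b -> comaximal a c -> comaximal a (b * c).
Proof.
move=> [s [t e]] [s' [t' e']].
exists (s * s' * a + s * t' * c + s' * t * b), (t * t').
by rewrite -[RHS](mulr1 1) -{1}e -e'; ring.
Qed.

Lemma comaximal_lin (R : comNzRingType) (x y a b p q r s : R) :
  comaximal x y -> x = p * a + q * b -> y = r * a + s * b -> comaximal a b.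
Proof.
move=> [t [v st]] xE yE; exists (t * p + v * r), (t * q + v * s).
by rewrite -[RHS]st xE yE; ring.
Qed.

Lemma comaximal_cube_bases (R : comNzRingType) (u v p q : R) :
  comaximal (u * p ^+ 3) (v * q ^+ 3) -> comaximal p q.
Proof.
move=> [s [t st]]; exists (s * u * p ^+ 2), (t * v * q ^+ 2).
by rewrite -[RHS]st; ring.
Qed.

(** Unique factorisation is bypassed by computing with ideals: if [d] generates
    [(a, c)], then [d^3] generates [(a^3, a^2 c, a c^2, c^3)]; as [c^3] is
    [a b] up to a unit, this ideal is [a (a^2, a c, c^2, b)], that is [(a)]
    because [a^2] and [b] are comaximal. *)
Lemma comaximal_mul_cube (R : idomainType) (u a b c d : R) :
    u \is a GRing.unit -> comaximal a b -> a * b = u * c ^+ 3 ->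
    divides d a -> divides d c -> (exists s t, d = s * a + t * c) ->
  exists2 v, v \is a GRing.unit & a = v * d ^+ 3.
Proof.
move=> uU [s [t st1]] abE [e aE] [f cE] [s' [t' dE]].
have [w uw] : exists w, w * u = 1 by exists u^-1; rewrite mulVr.
have cE3 : c ^+ 3 = a * (w * b).
  by rewrite mulrCA abE mulrA uw mul1r.
(* The coefficient of [a] in [(s' a + t' c)^3] once [c^3] is [w a b]. *)
pose m := s' ^+ 3 * a ^+ 2 + 3 * s' ^+ 2 * t' * a * c
          + 3 * s' * t' ^+ 2 * c ^+ 2 + t' ^+ 3 * w * b.
have dm : d ^+ 3 = m * a.
  have -> : m * a = (s' * a + t' * c) ^+ 3 by rewrite /m; ring: cE3.
  by rewrite -dE.
(* Squaring [s a + t b = 1] writes [a] in terms of [a^3] and [a b = u c^3],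
   both multiples of [d^3]; [k] is the resulting cofactor. *)
pose k := s ^+ 2 * e ^+ 3 + (2 * s * t * a + t ^+ 2 * b) * u * f ^+ 3.
have ak : a = k * d ^+ 3.
  have aE' : a = a * (s * a + t * b) ^+ 2 by rewrite st1 expr1n mulr1.
  rewrite {1}aE' /k.
  have -> : a * (s * a + t * b) ^+ 2
          = s ^+ 2 * a ^+ 3 + (2 * s * t * a + t ^+ 2 * b) * (a * b) by ring.
  by rewrite abE {1}aE cE; ring.
have [a0|a0] := eqVneq a 0.
  by exists 1; rewrite ?unitr1 // dm a0 !mulr0.
exists k => //; apply/unitrPr; exists m.
by apply: (mulIf a0); rewrite mul1r -mulrA -dm -ak.
Qed.

(** * The ring of Eisenstein integers *)

(** [Eis a b] stands for [a + b omega]. *)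
Record eis := Eis { eis0 : int; eis1 : int }.

Definition eis_pair x := (eis0 x, eis1 x).
Definition pair_eis p := Eis p.1 p.2.
Lemma eis_pairK : cancel eis_pair pair_eis. Proof. by case. Qed.
HB.instance Definition _ := Choice.copy eis (can_type eis_pairK).

Definition eis_add x y := Eis (eis0 x + eis0 y) (eis1 x + eis1 y).
Definition eis_opp x := Eis (- eis0 x) (- eis1 x).
Definition eis_mul x y :=
  Eis (eis0 x * eis0 y - eis1 x * eis1 y)
      (eis0 x * eis1 y + eis1 x * eis0 y - eis1 x * eis1 y).

Ltac eis_ring :=
  repeat match goal with x : eis |- _ => destruct x end;
  congr Eis; rewrite /=; ring.

Fact eis_addA : associative eis_add.
Proof. by move=> x y z; eis_ring. Qed.
Fact eis_addC : commutative eis_add.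
Proof. by move=> x y; eis_ring. Qed.
Fact eis_add0 : left_id (Eis 0 0) eis_add.
Proof. by move=> x; eis_ring. Qed.
Fact eis_addN : left_inverse (Eis 0 0) eis_opp eis_add.
Proof. by move=> x; eis_ring. Qed.
HB.instance Definition _ :=
  GRing.isZmodule.Build eis eis_addA eis_addC eis_add0 eis_addN.

Fact eis_mulA : associative eis_mul.
Proof. by move=> x y z; eis_ring. Qed.
Fact eis_mulC : commutative eis_mul.
Proof. by move=> x y; eis_ring. Qed.
Fact eis_mul1 : left_id (Eis 1 0) eis_mul.
Proof. by move=> x; eis_ring. Qed.
Fact eis_mulD : left_distributive eis_mul eis_add.
Proof. by move=> x y z; eis_ring. Qed.
Fact eis_1neq0 : Eis 1 0 != 0.
Proof. by []. Qed.
HB.instance Definition _ :=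
  GRing.Zmodule_isComNzRing.Build eis eis_mulA eis_mulC eis_mul1 eis_mulD
    eis_1neq0.

(** The conjugate is computed from [omega^2 = -1 - omega], the conjugate of
    [omega]; the norm is then [x] times its conjugate. *)
Definition eis_conj x := Eis (eis0 x - eis1 x) (- eis1 x).
Definition eis_norm x : int :=
  eis0 x ^+ 2 - eis0 x * eis1 x + eis1 x ^+ 2.

Lemma eis_mul_conj x : x * eis_conj x = Eis (eis_norm x) 0.
Proof. by rewrite /eis_norm; eis_ring. Qed.

Lemma eis_normM x y : eis_norm (x * y) = eis_norm x * eis_norm y.
Proof. by case: x y => a b [c d]; rewrite /eis_norm /=; ring. Qed.

Lemma eis_norm_conj x : eis_norm (eis_conj x) = eis_norm x.
Proof. by case: x => a b; rewrite /eis_norm /=; ring. Qed.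

(** Completing the square makes positivity visible. *)
Lemma eis_norm4 x :
  4 * eis_norm x = (2 * eis0 x - eis1 x) ^+ 2 + 3 * eis1 x ^+ 2.
Proof. by rewrite /eis_norm; ring. Qed.

Lemma eis_norm_ge0 x : 0 <= eis_norm x.
Proof.
have := sqr_ge0 (2 * eis0 x - eis1 x); have := sqr_ge0 (eis1 x).
by have := eis_norm4 x; lia.
Qed.

Lemma eis_norm_eq0 x : (eis_norm x == 0) = (x == 0).
Proof.
apply/eqP/eqP => [n0|-> //]; have := eis_norm4 x; rewrite n0.
have := sqr_ge0 (2 * eis0 x - eis1 x); have := sqr_ge0 (eis1 x).
move=> b_ge0 a_ge0 e; have /eqP : eis1 x ^+ 2 = 0 by lia.
have /eqP : (2 * eis0 x - eis1 x) ^+ 2 = 0 by lia.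
by rewrite !sqrf_eq0 {e a_ge0 b_ge0 n0}; case: x => a b /= /eqP ? /eqP ?; congr Eis; lia.
Qed.

Lemma eis_norm_gt0 x : (0 < eis_norm x) = (x != 0).
Proof. by rewrite lt0r eis_norm_ge0 andbT eis_norm_eq0. Qed.

Definition eis_unit : pred eis := fun x => eis_norm x == 1.
Definition eis_inv x := if eis_norm x == 1 then eis_conj x else x.

Fact eis_mulV : {in eis_unit, left_inverse 1 eis_inv *%R}.
Proof.
by move=> x /eqP n1; rewrite /eis_inv n1 eqxx mulrC eis_mul_conj n1.
Qed.

Fact eis_unitP x y : y * x = 1 -> eis_unit x.
Proof.
move=> /(congr1 eis_norm); rewrite eis_normM (_ : eis_norm 1 = 1) // => e.
have := eis_norm_ge0 x; have := eis_norm_ge0 y; rewrite /eis_unit.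
move: (eis_norm x) (eis_norm y) e => m n e n_ge0 m_ge0; apply/eqP.
by have : n <> 0; [lia | have : m <> 0; [lia | nia]].
Qed.

Fact eis_inv_out : {in [predC eis_unit], eis_inv =1 id}.
Proof. by move=> x /negPf x1; rewrite /eis_inv -/(eis_unit x) (x1 : eis_unit x = false). Qed.

HB.instance Definition _ :=
  GRing.ComNzRing_hasMulInverse.Build eis eis_mulV eis_unitP eis_inv_out.

Fact eis_integral : GRing.integral_domain_axiom eis.
Proof.
move=> x y /eqP; rewrite -eis_norm_eq0 eis_normM mulf_eq0.
by rewrite !eis_norm_eq0.
Qed.
HB.instance Definition _ := GRing.ComUnitRing_isIntegral.Build eis eis_integral.

Lemma eis_unitE (u : eis) : (u \is a GRing.unit) = (eis_norm u == 1).
Proof. by []. Qed.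

Lemma round_div (m D : int) : 0 < D -> exists k, `|2 * (m - k * D)| <= D.
Proof.
move=> D0; exists ((2 * m + D) %/ (2 * D))%Z.
have D2 : 2 * D != 0 by lia.
have := divz_eq (2 * m + D) (2 * D); have := modz_ge0 (2 * m + D) D2.
have : ((2 * m + D) %% (2 * D))%Z < 2 * D by apply: ltz_pmod; lia.
move: ((2 * m + D) %% _)%Z ((2 * m + D) %/ _)%Z => r q; lia.
Qed.

(** The quotient is [a / b] with both coordinates rounded to nearest integers.
    The error then has coordinates of size at most 1/2, so norm at most 3/4. *)
Lemma eis_division (a b : eis) :
  b != 0 -> exists q, eis_norm (a - q * b) < eis_norm b.
Proof.
rewrite -eis_norm_gt0 => b0; set D := eis_norm b in b0 *.
case E : (a * eis_conj b) => [m n].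
have [k kP] := round_div m _ b0; have [l lP] := round_div n _ b0.
(* Everything is multiplied by the conjugate of [b], so that the division is
   by the integer [D]. *)
have DE : D = eis_norm (eis_conj b) by rewrite eis_norm_conj.
exists (Eis k l); rewrite -(ltr_pM2r b0) {1}DE -eis_normM.
rewrite mulrBl E -mulrA eis_mul_conj -/D.
have -> : Eis m n - Eis k l * Eis D 0 = Eis (m - k * D) (n - l * D).
  by eis_ring.
rewrite /eis_norm /=; move: (m - _) (n - _) kP lP => r s; nia.
Qed.

Lemma eis_bezout (a b : eis) :
  exists d, [/\ divides d a, divides d b & exists s t, d = s * a + t * b].
Proof.
have [n] := ubnP `|eis_norm b|%N; elim: n a b => // n IHn a b lt_n.
have [->|b0] := eqVneq b 0.
  exists a; split; [by exists 1; rewrite mul1r | by exists 0; rewrite mul0r |].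
  by exists 1, 0; ring.
have [q qP] := eis_division a b b0.
have [|d [[e bE] [f rE] [s [t dE]]]] := IHn b (a - q * b).
  by have := eis_norm_ge0 (a - q * b); lia.
exists d; split; first by exists (f + q * e); rewrite -(subrK (q * b) a) rE bE; ring.
  by exists e.
by exists t, (s - t * q); rewrite dE; ring.
Qed.

(** * The ramified prime above 3 *)

Definition omega := Eis 0 1.
Definition lam : eis := 1 - omega.

Lemma omega2 : omega ^+ 2 = - 1 - omega. Proof. by []. Qed.
Lemma omega_unit : omega \is a GRing.unit. Proof. by []. Qed.
Lemma omega3 : omega ^+ 3 = 1. Proof. by []. Qed.
Lemma lam_sqr : lam ^+ 2 = - (3 * omega). Proof. by []. Qed.
Lemma norm_lam : eis_norm lam = 3. Proof. by []. Qed.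

(** Reduction modulo [lam]: it sends [omega] to 1. *)
Definition chi (x : eis) : 'F_3 := (eis0 x + eis1 x)%:~R.

Fact chi_zmod : zmod_morphism chi.
Proof. by move=> x y; rewrite /chi -rmorphB; congr _%:~R; rewrite /=; ring. Qed.
HB.instance Definition _ := GRing.isZmodMorphism.Build eis 'F_3 chi chi_zmod.

Fact chi_monoid : monoid_morphism chi.
Proof.
split=> // x y; rewrite /chi -intrM.
have -> : eis0 (x * y) + eis1 (x * y)
        = (eis0 x + eis1 x) * (eis0 y + eis1 y) - 3 * (eis1 x * eis1 y).
  by rewrite /=; ring.
have three0 : 3%:~R = 0 :> 'F_3 by apply: val_inj.
by rewrite intrB [X in _ - X]intrM three0 mul0r subr0.
Qed.
HB.instance Definition _ := GRing.isMonoidMorphism.Build eis 'F_3 chi chi_monoid.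

(** The morphism laws are restated for [chi] itself, since the generic ones
    leave it wrapped in its structure and block rewriting. *)
Lemma chiD x y : chi (x + y) = chi x + chi y. Proof. exact: rmorphD. Qed.
Lemma chiB x y : chi (x - y) = chi x - chi y. Proof. exact: rmorphB. Qed.
Lemma chiM x y : chi (x * y) = chi x * chi y. Proof. exact: rmorphM. Qed.
Lemma chiX x n : chi (x ^+ n) = chi x ^+ n. Proof. exact: rmorphXn. Qed.
Lemma chi1 : chi 1 = 1. Proof. exact: rmorph1. Qed.
Lemma chiN1 : chi (- 1) = - 1. Proof. exact: val_inj. Qed.
Lemma chi_lam : chi lam = 0. Proof. exact: val_inj. Qed.
Lemma chi_omega : chi omega = 1. Proof. exact: val_inj. Qed.

Lemma intrF3_eq0 (m : int) : (m%:~R == 0 :> 'F_3) = (3 %| m)%Z.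
Proof.
have pF3 := pchar_Fp (isT : prime 3).
case: m => n; first by rewrite -[LHS](dvdn_pcharf pF3).
by rewrite NegzE rmorphN oppr_eq0 -[LHS](dvdn_pcharf pF3) dvdzE abszN.
Qed.

Lemma chi_eq0 x : chi x = 0 -> divides lam x.
Proof.
move=> /eqP; rewrite intrF3_eq0; case: x => a b /= /dvdzP [q qE].
exists (Eis (a - q) q); rewrite /lam /omega; congr Eis; rewrite /=; lia.
Qed.

Lemma chi_unit (u : eis) : u \is a GRing.unit -> chi u <> 0.
Proof.
by move=> /(rmorph_unit chi) uU u0; move: uU; rewrite /= u0 unitr0.
Qed.

Lemma F3_cases (t : 'F_3) : [\/ t = 0, t = 1 | t = - 1].
Proof.
case: t => [[|[|[|]]] //= lt]; [apply: Or31|apply: Or32|apply: Or33]; exact: val_inj.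
Qed.

Lemma F3_cube (t : 'F_3) : t ^+ 3 = t.
Proof. by case: (F3_cases t) => ->; apply: val_inj. Qed.

(** Such an [x] is [s + m lam] with [s] equal to 1 or -1, and when this is
    cubed every term but [s^3 = s] is a multiple of 3, because [lam^2] is.
    The sign is recorded by [s^2 = 1], the only property used later. *)
Lemma cube_mod3 x : chi x <> 0 ->
  exists s m, s ^+ 2 = 1 /\ x ^+ 3 = s + 3 * m.
Proof.
move=> x0; have [s [ss xs]] : exists s : eis, s ^+ 2 = 1 /\ chi (x - s) = 0.
  case: (F3_cases (chi x)) => // xE; [exists 1|exists (- 1)]; split=> //.
    by rewrite chiB xE chi1 subrr.
  by rewrite chiB xE chiN1 subrr.
have [m mE] := chi_eq0 _ xs; have -> : x = m * lam + s by rewrite -mE subrK.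
exists s, (m ^+ 3 * (- omega) * lam - 3 * omega * m ^+ 2 * s + m * lam); split=> //.
by ring: lam_sqr ss.
Qed.

(** Both [e] and [s] have norm 1, so that [e - s] has norm at most 4 by the
    parallelogram law, whereas nonzero multiples of 3 have norm at least 9. *)
Lemma unit_mod3 (e s m : eis) :
  e \is a GRing.unit -> s ^+ 2 = 1 -> e = s + 3 * m -> e = s.
Proof.
rewrite eis_unitE => /eqP e1 ss eE.
have s1 : eis_norm s = 1.
  have := congr1 eis_norm ss; have := eis_norm_ge0 s.
  by rewrite expr2 eis_normM (_ : eis_norm 1 = 1) //; move: (eis_norm s) => n; nia.
suff m0 : m = 0 by rewrite eE m0 mulr0 addr0.
apply/eqP; rewrite -eis_norm_eq0.
have par : eis_norm (e - s) + eis_norm (e + s) = 2 * (eis_norm e + eis_norm s).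
  by case: (e) (s) => a b [c d]; rewrite /eis_norm /=; ring.
have : eis_norm (e - s) = 9 * eis_norm m.
  by rewrite eE addrAC subrr add0r eis_normM.
have := eis_norm_ge0 (e + s); have := eis_norm_ge0 m; lia.
Qed.

(** * The descent *)

(** Write [x + y = a lam]. Then [x + omega^i y = (a - k y) lam] where [k] is 0,
    1, [1 + omega] for [i] equal to 0, 1, 2; since these [k] have residues
    0, 1, 2 and [y] has nonzero residue, one of the [a - k y] is divisible by
    [lam]. *)
Lemma normalize_factor (x y u z : eis) :
    comaximal x y -> divides lam z -> x ^+ 3 + y ^+ 3 = u * z ^+ 3 ->
  exists y' a, [/\ y' ^+ 3 = y ^+ 3, comaximal x y' & x + y' = lam ^+ 2 * a].
Proof.
move=> cxy [z' zE] e.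
have xy0 : chi (x + y) = 0.
  rewrite -[LHS]F3_cube -chiX.
  (* [3 = - lam^2 omega^2] *)
  have -> : (x + y) ^+ 3
    = lam * (u * z' ^+ 3 * lam ^+ 2 - lam * omega ^+ 2 * (x ^+ 2 * y + x * y ^+ 2)).
    rewrite mulrBr; have -> : lam * (u * z' ^+ 3 * lam ^+ 2) = x ^+ 3 + y ^+ 3.
      by rewrite e zE; ring.
    by ring: omega3 lam_sqr.
  by rewrite chiM chi_lam mul0r.
have [a aE] := chi_eq0 _ xy0.
have y0 : chi y <> 0.
  move=> y0; have x0 : chi x = 0 by move: xy0; rewrite chiD y0 addr0.
  case: cxy => [s [t /(congr1 chi)]].
  by rewrite chiD !chiM x0 y0 !mulr0 addr0 chi1 => /eqP.
(* [v] is the cube root of unity [omega^i], and [w] its inverse. *)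
have main k : chi (a - k * y) = 0 -> x + y = a * lam ->
    forall v w, v ^+ 3 = 1 -> w * v = 1 -> v = 1 - k * lam ->
  exists y' a, [/\ y' ^+ 3 = y ^+ 3, comaximal x y' & x + y' = lam ^+ 2 * a].
  move=> /chi_eq0 [a' a'E] xyE v w v3 wv vE; exists (v * y), a'; split.
  - by rewrite exprMn v3 mul1r.
  - case: cxy => [s [t st]]; exists s, (t * w).
    by rewrite -[RHS]st; ring: wv.
  - have -> : x + v * y = (a - k * y) * lam by rewrite mulrBl -xyE vE; ring.
    by rewrite a'E; ring.
case: (F3_cases (chi a)) => a0.
- by apply: (main 0 _ aE 1 1); rewrite ?mul0r ?subr0.
- case: (F3_cases (chi y)) => // yE.
  + by apply: (main 1 _ aE omega (omega ^+ 2)); rewrite ?mul1r // chiB a0 yE subrr.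
  + apply: (main (1 + omega) _ aE (omega ^+ 2) omega) => //.
    by rewrite chiB chiM chiD a0 yE chi_omega chi1; apply: val_inj.
- case: (F3_cases (chi y)) => // yE.
  + apply: (main (1 + omega) _ aE (omega ^+ 2) omega) => //.
    by rewrite chiB chiM chiD a0 yE chi_omega chi1; apply: val_inj.
  + by apply: (main 1 _ aE omega (omega ^+ 2)); rewrite ?mul1r // chiB a0 yE subrr.
Qed.

Lemma comaximal_gcd_cube (u a b c : eis) :
    u \is a GRing.unit -> comaximal a b -> a * b = u * c ^+ 3 ->
  exists v d, [/\ v \is a GRing.unit, a = v * d ^+ 3 & divides d c].
Proof.
move=> uU cab e; have [d [da dc dE]] := eis_bezout a c.
by have [v vU aE] := comaximal_mul_cube _ _ _ _ _ _ uU cab e da dc dE;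
  exists v, d.
Qed.

(** The new [z1] is the base of the cube in the factor divisible by [lam^2];
    it divides [z / lam], so its norm is at most a third of that of [z]. *)
Lemma descent_step (x y u z : eis) :
    u \is a GRing.unit -> comaximal x y -> divides lam z -> z != 0 ->
    x ^+ 3 + y ^+ 3 = u * z ^+ 3 ->
  exists x1 y1 u1 z1, [/\ u1 \is a GRing.unit, comaximal x1 y1,
     divides lam z1, z1 != 0 & x1 ^+ 3 + y1 ^+ 3 = u1 * z1 ^+ 3] /\
     eis_norm z1 < eis_norm z.
Proof.
move=> uU cxy lz z0 e.
have [y' [a' [y'E cxy' xyE]]] := normalize_factor x y u z cxy lz e.
move: e; rewrite -y'E {y cxy y'E} => e; rename y' into y, cxy' into cxy.
case: lz => z' zE; rewrite zE in z0 e *.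
have [z'0 _] : z' != 0 /\ lam != 0 by apply/norP; rewrite -mulf_eq0.
(* The factors [x + y], [x + omega y], [x + omega^2 y] divided by [lam]. *)
pose a := lam * a'; pose b := a - y; pose c := a + omega ^+ 2 * y.
have xE : x = lam * a - y by rewrite /a mulrA -expr2 -xyE addrK.
have abc : a * b * c = u * z' ^+ 3.
  have l3 : lam ^+ 3 != 0 by [].
  apply: (mulfI l3); rewrite [RHS](_ : _ = u * (z' * lam) ^+ 3); last by ring.
  rewrite -e xE /b /c /lam; ring: omega2.
(* Any two of [a], [b], [c] determine [x] and [y] linearly, without
   denominators, so they inherit comaximality. *)
have cab : comaximal a b.
  by apply: (comaximal_lin _ x y a b (lam - 1) 1 1 (-1)) => //;
    rewrite ?xE /b; ring.
have cac : comaximal a c.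
  by apply: (comaximal_lin _ x y a c 1 (- omega) (-omega) omega) => //;
    rewrite ?xE /c /lam; ring: omega3.
have cbc : comaximal b c.
  by apply: (comaximal_lin _ x y b c (- omega) 1 (omega ^+ 2) (- omega ^+ 2)) => //;
    rewrite ?xE /b /c /lam; ring: omega2.
have sum0 : a + omega * b + omega ^+ 2 * c = 0 by rewrite /b /c; ring: omega2.
have a0 : a != 0.
  apply: contraNneq z'0 => a0; move/eqP: abc.
  rewrite a0 !mul0r eq_sym mulf_eq0 expf_eq0 /=.
  by case/orP => // /eqP u0; rewrite u0 unitr0 in uU.
have [||u1 [p [u1U aE [k pz]]]] := comaximal_gcd_cube u a (b * c) z' uU.
  by apply: comaximalMr.
  by rewrite mulrA.
have [||u2 [q [u2U bE _]]] := comaximal_gcd_cube u b (a * c) z' uU.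
  by apply: comaximalMr => //; apply: comaximal_sym.
  by rewrite -abc; ring.
have [||u3 [r [u3U cE _]]] := comaximal_gcd_cube u c (a * b) z' uU.
  by apply: comaximalMr; apply: comaximal_sym.
  by rewrite -abc; ring.
have p0 : p != 0 by apply: contraNneq a0 => p0; rewrite aE p0 expr0n mulr0.
have chip : chi p = 0.
  have /eqP : chi a = 0 by rewrite /a chiM chi_lam mul0r.
  rewrite aE chiM chiX F3_cube mulf_eq0 => /orP [/eqP /(chi_unit _ u1U) //|/eqP //].
have cqr : comaximal q r by apply: (comaximal_cube_bases _ u2 u3); rewrite -bE -cE.
have cpq : comaximal p q by apply: (comaximal_cube_bases _ u1 u2); rewrite -aE -bE.
have cpr : comaximal p r by apply: (comaximal_cube_bases _ u1 u3); rewrite -aE -cE.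
have not_chi0 w : comaximal p w -> chi w <> 0.
  move=> [s [t /(congr1 chi)]] st w0; move: st.
  by rewrite chiD !chiM chip w0 !mulr0 addr0 chi1 => /eqP.
(* Dividing [a + omega b + omega^2 c = 0] by [omega u2] gives these units. *)
pose ep := omega * u3 / u2; pose ep' := - (omega ^+ 2 * u1 / u2).
have epU : ep \is a GRing.unit by rewrite /ep !unitrM unitrV u2U u3U omega_unit.
have ep'U : ep' \is a GRing.unit.
  by rewrite /ep' unitrN !unitrM unitrV u2U u1U omega_unit.
have eqr : q ^+ 3 + ep * r ^+ 3 = ep' * p ^+ 3.
  apply: (mulrI u2U).
  have iu2 : u2 * u2^-1 = 1 by rewrite mulrV.
  have h : u1 * p ^+ 3 + omega * (u2 * q ^+ 3) + omega ^+ 2 * (u3 * r ^+ 3) = 0.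
    by rewrite -aE -bE -cE.
  have hq : u2 * q ^+ 3 = - omega * (u3 * r ^+ 3) - omega ^+ 2 * (u1 * p ^+ 3).
    apply/eqP; rewrite -subr_eq0; apply/eqP; rewrite -[RHS](mulr0 (omega ^+ 2)) -h.
    by ring: omega3.
  rewrite /ep /ep' mulrDr hq; ring: iu2.
have [s1 [m1 [ss1 q3]]] := cube_mod3 q (not_chi0 _ cpq).
have [s2 [m2 [ss2 r3]]] := cube_mod3 r (not_chi0 _ cpr).
have [l pE] := chi_eq0 _ chip.
pose s := - (s1 * s2).
have ss : s ^+ 2 = 1 by rewrite /s; ring: ss1 ss2.
(* Modulo 3 the relation reads [s1 + ep s2 = 0], as [3] divides [lam^3]. *)
have eps : ep = s.
  apply: (unit_mod3 ep s (s2 * (- (omega * ep' * lam) * l ^+ 3 - m1 - ep * m2))) => //.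
  apply/eqP; rewrite -subr_eq0; apply/eqP.
  have h : s1 + 3 * m1 + ep * (s2 + 3 * m2) - ep' * (l * lam) ^+ 3 = 0.
    by rewrite -q3 -r3 -pE eqr subrr.
  rewrite -[RHS](mulr0 s2) -h /s; ring: ss2 lam_sqr.
exists q, (s * r), ep', p; split; first split=> //.
- have [t [v tv]] := cqr; exists t, (v * s); rewrite -[RHS]tv; ring: ss.
- by exists l.
- rewrite -eqr eps; ring: ss.
have k0 : k != 0 by apply: contraNneq z'0 => k0; rewrite pz k0 mul0r.
rewrite pz !eis_normM norm_lam; move: p0 k0; rewrite -!eis_norm_gt0.
by move: (eis_norm p) (eis_norm k) => m n; nia.
Qed.

Lemma no_lam_solution (x y u z : eis) :
    u \is a GRing.unit -> comaximal x y -> divides lam z ->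
    x ^+ 3 + y ^+ 3 = u * z ^+ 3 ->
  z = 0.
Proof.
have [n] := ubnP `|eis_norm z|%N; elim: n x y u z => // n IHn x y u z.
move=> lt_n uU cxy lz e.
apply/eqP; apply: contraT => z0.
have [x1 [y1 [u1 [z1 [[u1U cxy1 lz1 z10 e1] lt1]]]]] :=
  descent_step x y u z uU cxy lz z0 e.
have : z1 = 0; last by move/eqP; rewrite (negPf z10).
apply: (IHn x1 y1 u1 z1) => //.
have := eis_norm_ge0 z1; lia.
Qed.

(** * Back to the rational integers *)

Lemma intr_eisE (m : int) : m%:~R = Eis m 0.
Proof.
have nat_eisE n : n%:R = Eis n 0 by elim: n => // n IHn; rewrite mulrS IHn.
by case: m => n; rewrite ?NegzE ?rmorphN /= -[_ *~ _]/(_%:R) nat_eisE.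
Qed.

Lemma coprime_no_solution (x y z : int) :
  coprimez x y -> (3 %| z)%Z -> z != 0 -> x ^+ 3 + y ^+ 3 + z ^+ 3 <> 0.
Proof.
move=> cxy /dvdzP [k zE] z0 e.
have : (z%:~R : eis) = 0.
  apply: (no_lam_solution x%:~R y%:~R (- 1)).
  - by rewrite unitrN1.
  - case/coprimezP: cxy => [[s t] /= st]; exists s%:~R, t%:~R.
    by rewrite -!rmorphM -rmorphD st.
  - exists (k%:~R * lam * - omega ^+ 2).
    by rewrite zE intrM; ring: lam_sqr omega3.
  - have -> : x%:~R ^+ 3 + y%:~R ^+ 3 = (x ^+ 3 + y ^+ 3)%:~R :> eis.
      by rewrite rmorphD !rmorphXn.
    have -> : x ^+ 3 + y ^+ 3 = - z ^+ 3 by lia.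
    by rewrite rmorphN rmorphXn mulN1r.
by rewrite intr_eisE => -[z00]; rewrite z00 in z0.
Qed.

Lemma dvdz_cube (x y : int) : (x ^+ 3 %| y ^+ 3)%Z = (x %| y)%Z.
Proof. by rewrite !dvdzE !abszX dvdn_pexp2r. Qed.

Lemma prime_dvdz_mul (p : nat) (x y : int) : prime p ->
  (p %| x * y)%Z = (p %| x)%Z || (p %| y)%Z.
Proof. by move=> pp; rewrite !dvdzE abszM /= Euclid_dvdM. Qed.

(** With [e1], [e2], [e3] the elementary symmetric functions,
    [x^3 + y^3 + z^3 = e1^3 - 3 e1 e2 + 3 e3]. If this vanishes then 3 divides
    [e1^3], hence [e1], hence [e3 = e1 e2 - e1^3 / 3]. *)
Lemma three_dvd_cubes (x y z : int) :
  x ^+ 3 + y ^+ 3 + z ^+ 3 = 0 -> (3 %| x * y * z)%Z.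
Proof.
move=> e; have p3 : prime 3 by [].
have e3 : (x + y + z) ^+ 3
    = 3 * ((x + y + z) * (x * y + y * z + z * x) - x * y * z).
  by rewrite -[RHS]add0r -e; ring.
have /dvdzP [k kE] : (3 %| x + y + z)%Z.
  have : (3 %| (x + y + z) ^+ 3)%Z by rewrite e3 dvdz_mulr.
  by rewrite !exprS expr0 mulr1 !(prime_dvdz_mul 3) // !orbb.
apply/dvdzP; exists (k * (x * y + y * z + z * x) - 3 * k ^+ 3).
apply: (mulfI (isT : 3 != 0 :> int)).
have -> : 3 * (x * y * z)
    = 3 * (x + y + z) * (x * y + y * z + z * x) - (x + y + z) ^+ 3.
  by rewrite e3; ring.
by rewrite kE; ring.
Qed.

(** [y] and [z^3 = - x^3 - y^3] are coprime since [y] and [x^3] are; the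
    coefficients come from cubing the relation between [x] and [y]. *)
Lemma coprime_cubes (x y z : int) :
  coprimez x y -> x ^+ 3 + y ^+ 3 + z ^+ 3 = 0 -> coprimez y z.
Proof.
move=> /coprimezP [[s t] /= st] e.
rewrite -(@coprimez_pexpr 3) //.
apply/coprimezP; exists (t ^+ 3 * y ^+ 2 + 3 * s * t ^+ 2 * x * y
  + 3 * s ^+ 2 * t * x ^+ 2 - s ^+ 3 * y ^+ 2, - s ^+ 3) => /=.
transitivity ((s * x + t * y) ^+ 3 - s ^+ 3 * (x ^+ 3 + y ^+ 3 + z ^+ 3)).
  by ring.
by rewrite st expr1n e mulr0 subr0.
Qed.

Lemma gcdz_cofactors (x y : int) : x != 0 ->
  exists g x' y', [/\ g != 0, x = x' * g, y = y' * g & coprimez x' y'].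
Proof.
move=> x0; have g0 : gcdz x y != 0 by rewrite gcdz_eq0 negb_and x0.
have /dvdzP [x' xE] := dvdz_gcdl x y; have /dvdzP [y' yE] := dvdz_gcdr x y.
exists (gcdz x y), x', y'; split=> //; apply/eqP; apply: (mulIf g0).
by have := mulz_gcdl x' y' (gcdz x y); rewrite -xE -yE mul1r gez0_abs.
Qed.

Lemma no_solution_sum (x y z : int) :
  x != 0 -> y != 0 -> z != 0 -> x ^+ 3 + y ^+ 3 + z ^+ 3 <> 0.
Proof.
move=> x0; have [g [x' [y' [g0 xE yE cxy]]]] := gcdz_cofactors x y x0.
move: x0; rewrite {}xE {}yE => x0 y0 z0 e.
have /dvdzP [z' zE] : (g %| z)%Z.
  rewrite -dvdz_cube; apply/dvdzP; exists (- (x' ^+ 3 + y' ^+ 3)).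
  by apply/eqP; rewrite -subr_eq0 -[X in _ == X]e; apply/eqP; ring.
move: x0 y0 z0 e; rewrite {}zE !mulf_eq0 !negb_or.
move=> /andP [x0 _] /andP [y0 _] /andP [z0 _] e.
have {}e : x' ^+ 3 + y' ^+ 3 + z' ^+ 3 = 0.
  by apply: (mulIf (expf_neq0 3 g0)); rewrite mul0r -e; ring.
have cyz := coprime_cubes x' y' z' cxy e.
have : (3 %| x' * y' * z')%Z := three_dvd_cubes x' y' z' e.
rewrite !(prime_dvdz_mul 3) // => /orP [/orP [d3|d3]|d3].
- by apply: (coprime_no_solution y' z' x'); rewrite // -e; ring.
- apply: (coprime_no_solution z' x' y'); rewrite // -?e; last by ring.
  by apply: (coprime_cubes y' z' x') => //; rewrite -e; ring.
- exact: (coprime_no_solution x' y' z').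
Qed.

Theorem corollary4p2 :
  (~ exists A B C : int,
       [/\ 0 < A, 0 < B, 0 < C & A ^+ 3 + B ^+ 3 = C ^+ 3]) /\
  (~ exists x y z : int,
       [/\ x != 0, y != 0, z != 0 & x ^+ 3 + y ^+ 3 + z ^+ 3 = 0]).
Proof.
split=> [[A [B [C [A0 B0 C0 e]]]] | [x [y [z [x0 y0 z0 e]]]]].
  apply: (no_solution_sum A B (- C)); rewrite ?oppr_eq0 ?gt_eqF //.
  by rewrite e; ring.
exact: (no_solution_sum x y z).
Qed.
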